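(* Let $q$ be a prime power. Let $c_A(n,q)$ (resp. $c_{GL}(n,q)$) be the proportion of cyclic elements in $A(n,q)$ (resp. $GL(n,q)$), $C_A(u,q)=\sum_{n\ge0}c_A(n,q)u^n$ and $C_{GL}(u,q)=\sum_{n\ge0}c_{GL}(n,q)u^n$. Then as formal power series \[ C_A(u,q)=\frac{1}{1-u/q}\prod_{d\ge1}\Bigl(1+\frac{u^d}{(q^d-1)(1-u^d/q^d)}\Bigr)^{N'(d,q)}=\frac{1}{1-u/q}\cdot\frac{1}{1+\frac{u}{(q-1)(1-u/q)}}\,C_{GL}(u,q). \]
   Context: $A(n,q)$ is the group of matrices $x\in GL(n+1,q)$ with $x_{11}=1$ and $x_{j1}=0$ for $j\ge2$, viewed in $GL(n+1,q)$. A matrix is cyclic if its minimal polynomial equals its characteristic polynomial. $GL(0,q)$ is trivial, $c_{GL}(0,q)=1$. $N(d,q)$ is the number of monic irreducible polynomials of degree $d$ over $\mathbb{F}_q$; $N'(d,q)=N(d,q)$ for $d>1$ and $N'(1,q)=q-2$. *)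

(* Defs.v *)
From HB Require Import structures.
From mathcomp Require Import all_boot all_order all_algebra all_field.
From mathcomp Require Import boolp.
Set Implicit Arguments. Unset Strict Implicit. Unset Printing Implicit Defensive.
Import GRing.Theory.
Local Open Scope ring_scope.

Definition series := nat -> rat.

Definition ps_C (c : rat) : series := fun n => if n == 0%N then c else 0.
Definition ps1 : series := ps_C 1.
Definition ps_X (d : nat) : series := fun n => if n == d then 1 else 0.
Definition ps_add (f g : series) : series := fun n => f n + g n.
Definition ps_scale (c : rat) (f : series) : series := fun n => c * f n.
Definition ps_mul (f g : series) : series :=
  fun n => \sum_(i < n.+1) f i * g (n - i)%N.
Definition ps_pow (f : series) (k : nat) : series := iter k (ps_mul f) ps1.

(* multiplicative inverse of a series with invertible constant term:
   g_0 = f_0^-1,  g_n = - f_0^-1 * sum_{i=1}^{n} f_i g_{n-i} *)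
Fixpoint ps_inv_seq (f : series) (n : nat) : seq rat :=
  match n with
  | 0 => [:: (f 0%N)^-1]
  | m.+1 => let s := ps_inv_seq f m in
            rcons s (- (f 0%N)^-1 * \sum_(i < m.+1) f i.+1 * nth 0 s (m - i)%N)
  end.
Definition ps_inv (f : series) : series := fun n => nth 0 (ps_inv_seq f n) n.

(* infinite product prod_{d>=1} F d, where F d = 1 + O(u^d): the coefficient of
   u^n only depends on the factors with d <= n *)
Definition ps_infprod (F : nat -> series) : series :=
  fun n => (\big[ps_mul/ps1]_(1 <= d < n.+1) F d) n.

Section FF.
Variable F : finFieldType.

Definition qq : rat := (#|F|)%:R.

Definition cyclicmx (n : nat) (A : 'M[F]_n.+1) : bool := mxminpoly A == char_poly A.

(* proportion of cyclic elements in GL(n,q); c_GL(0,q) = 1 by convention *)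
Definition cGL (n : nat) : rat :=
  match n with
  | 0 => 1
  | m.+1 => (#|[set A : 'M[F]_m.+1 | (A \in unitmx) && cyclicmx A]|)%:R
            / (#|[set A : 'M[F]_m.+1 | A \in unitmx]|)%:R
  end.

(* A(n,q) <= GL(n+1,q): x_11 = 1, x_j1 = 0 for j >= 2 *)
Definition Aff (n : nat) : {set 'M[F]_n.+1} :=
  [set x : 'M[F]_n.+1 | [&& x \in unitmx, x ord0 ord0 == 1 &
                          [forall j : 'I_n.+1, (j != ord0) ==> (x j ord0 == 0)]]].

Definition cA (n : nat) : rat :=
  (#|[set x in Aff n | cyclicmx x]|)%:R / (#|Aff n|)%:R.

(* N(d,q): monic irreducible polynomials of degree d, i.e. 'X^d + (lower terms) *)
Definition Nirr (d : nat) : nat :=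
  #|[set v : 'rV[F]_d | `[< irreducible_poly ('X^d + rVpoly v) >] ]|.

Definition Nprime (d : nat) : nat := if d == 1%N then (#|F| - 2)%N else Nirr d.

Definition C_A : series := cA.
Definition C_GL : series := cGL.

Definition one_minus_uq (d : nat) : series :=
  ps_add ps1 (ps_scale (- (qq ^+ d)^-1) (ps_X d)).

Definition factor (d : nat) : series :=
  ps_add ps1 (ps_mul (ps_X d)
     (ps_inv (ps_mul (ps_C (qq ^+ d - 1)) (one_minus_uq d)))).

Definition RHS_prod : series :=
  ps_mul (ps_inv (one_minus_uq 1))
         (ps_infprod (fun d => ps_pow (factor d) (Nprime d))).

Definition RHS_GL : series :=
  ps_mul (ps_inv (one_minus_uq 1))
         (ps_mul (ps_inv (factor 1)) C_GL).
End FF.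

(* Main.v *)
(* Write [phi p] for the number of polynomials of degree < deg p coprime to [p]. Sending a
   pair (A, w), with [w] a cyclic row vector of [A], to the matrix with rows w A^i is a bijection
   between the pairs with char_poly A = p and GL(n, q); a cyclic [A] has exactly phi p cyclic
   vectors, so there are |GL(n, q)| / phi p cyclic matrices with characteristic polynomial [p].
   Hence C_GL is the sum of u^(deg p) / phi p over the monic [p] prime to X. For the affine group,
   count the pairs (x, v) with x cyclic and x v = v != 0: since GL is transitive on nonzero
   columns and the fixed space of [x] has dimension at most 1, c_A(n, q) is (q - 1) times the sum
   of 1 / phi p over the monic [p] of degree n + 1 prime to X and divisible by X - 1.
   Finally, for f irreducible of degree d, phi (f r) is q^d phi r or (q^d - 1) phi r according to
   whether f divides r; this splits off the Euler factor of f from such a sum. *)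

Require Import Defs.
From HB Require Import structures.
From mathcomp Require Import all_boot all_order all_algebra all_field.
From mathcomp Require Import boolp.
Set Implicit Arguments. Unset Strict Implicit. Unset Printing Implicit Defensive.
Import Order.TTheory GRing.Theory Num.Theory.
Local Open Scope ring_scope.

(** * Formal power series *)

Definition ps_trunc (N : nat) (f : series) : {poly rat} := \poly_(i < N) f i.

(** Coefficients below [N] see only the truncations, so the laws of [ps_mul] are inherited from
    [{poly rat}]. *)
Lemma ps_mul_trunc N f g n :
  (n < N)%N -> ps_mul f g n = (ps_trunc N f * ps_trunc N g)`_n.
Proof.
move=> ltnN; rewrite coefM; apply: eq_bigr => i _.
by rewrite !coef_poly (leq_ltn_trans _ ltnN) ?leq_ord // (leq_ltn_trans _ ltnN) ?leq_subr.
Qed.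

Lemma ps_mulC : commutative ps_mul.
Proof.
by move=> f g; apply/funext => n; rewrite !(@ps_mul_trunc n.+1) // mulrC.
Qed.

Lemma ps_mulA : associative ps_mul.
Proof.
have trM N f g n : (n < N)%N ->
  (ps_trunc N (ps_mul f g))`_n = (ps_trunc N f * ps_trunc N g)`_n.
  by move=> ltnN; rewrite coef_poly ltnN (ps_mul_trunc _ _ ltnN).
move=> f g h; apply/funext => n; rewrite !(@ps_mul_trunc n.+1) //.
transitivity (ps_trunc n.+1 f * (ps_trunc n.+1 g * ps_trunc n.+1 h))`_n.
  by rewrite !(coefM (ps_trunc n.+1 f)); apply: eq_bigr => i _; rewrite trM // ltnS leq_subr.
rewrite mulrA ![in LHS]coefM ![in RHS]coefM.
by apply: eq_bigr => i _; rewrite trM.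
Qed.

Lemma ps_mul1f : left_id ps1 ps_mul.
Proof.
move=> f; apply/funext => n; rewrite /ps_mul big_ord_recl mul1r subn0.
by rewrite big1 ?addr0 // => i _; rewrite mul0r.
Qed.

HB.instance Definition _ := Monoid.isComLaw.Build series ps1 ps_mul ps_mulA ps_mulC ps_mul1f.

Lemma ps_mulDl f g h : ps_mul (ps_add f g) h = ps_add (ps_mul f h) (ps_mul g h).
Proof.
apply/funext => n; rewrite /ps_mul /ps_add -big_split.
by apply: eq_bigr => i _; rewrite mulrDl.
Qed.

Lemma ps_mulCs c f : ps_mul (ps_C c) f = ps_scale c f.
Proof.
apply/funext => n; rewrite /ps_mul big_ord_recl /= subn0.
by rewrite big1 ?addr0 // => i _; rewrite mul0r.
Qed.

Lemma ps_mulZl c f g : ps_mul (ps_scale c f) g = ps_scale c (ps_mul f g).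
Proof. by rewrite -!ps_mulCs ps_mulA. Qed.

Lemma ps_mulXE d f n :
  ps_mul (ps_X d) f n = if (d <= n)%N then f (n - d)%N else 0.
Proof.
rewrite /ps_mul /ps_X; case: leqP => [ledn|ltnd].
  rewrite (bigD1 (Ordinal (ledn : (d < n.+1)%N))) //= eqxx mul1r.
  rewrite big1 ?addr0 // => i /eqP neq_i; case: eqP => [eq_i|]; last by rewrite mul0r.
  by case: neq_i; apply: val_inj.
rewrite big1 // => i _; case: eqP => [eq_i|]; last by rewrite mul0r.
by move: ltnd; rewrite -eq_i ltnNge leq_ord.
Qed.

Lemma size_ps_inv_seq f n : size (ps_inv_seq f n) = n.+1.
Proof. by elim: n => //= n IHn; rewrite size_rcons IHn. Qed.

Lemma nth_ps_inv_seq f n i : (i <= n)%N -> nth 0 (ps_inv_seq f n) i = ps_inv f i.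
Proof.
elim: n => [|n IHn]; first by rewrite leqn0 => /eqP ->.
rewrite leq_eqVlt => /predU1P[-> //|ltin].
by rewrite /= nth_rcons size_ps_inv_seq ltin IHn.
Qed.

Lemma ps_invS f n :
  ps_inv f n.+1 = - (f 0%N)^-1 * \sum_(i < n.+1) f i.+1 * ps_inv f (n - i)%N.
Proof.
rewrite /ps_inv /= nth_rcons size_ps_inv_seq ltnn eqxx; congr (_ * _).
by apply: eq_bigr => i _; rewrite nth_ps_inv_seq ?leq_subr.
Qed.

Lemma ps_mul_inv f : f 0%N != 0 -> ps_mul f (ps_inv f) = ps1.
Proof.
move=> f0; apply/funext => -[|n]; rewrite /ps_mul.
  by rewrite big_ord1 /ps_inv /= mulfV.
rewrite big_ord_recl subn0 ps_invS mulrA mulrN mulfV // mulN1r.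
by apply/eqP; rewrite addrC subr_eq0; apply/eqP; apply: eq_bigr.
Qed.

Lemma ps_mul_eq_inv f g h : f 0%N != 0 -> ps_mul f g = h -> g = ps_mul (ps_inv f) h.
Proof. by move=> f0 <-; rewrite ps_mulA (ps_mulC _ f) ps_mul_inv // ps_mul1f. Qed.

(** Coefficient [n] of a product involves only [g 0], ..., [g n]; this lets a finite product stand
    for the infinite one. *)
Lemma ps_mul_eq1_trunc f g n :
  (forall k, (k <= n)%N -> g k = ps1 k) -> ps_mul f g n = f n.
Proof.
move=> g1; rewrite -[in RHS](ps_mul1f f) ps_mulC /ps_mul.
by apply: eq_bigr => i _; rewrite g1 // leq_ord.
Qed.

(** * Polynomials over a finite field *)

Lemma irreducible_divisor (K : fieldType) (p : {poly K}) :
  (1 < size p)%N -> exists f, [/\ f \is monic, irreducible_poly f & f %| p].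
Proof.
have [n] := ubnP (size p); elim: n p => // n IHn p lt_pn p_gt1.
have [irr_p|red_p] := pselect (irreducible_poly p).
  exists ((lead_coef p)^-1 *: p).
  have lp0 : lead_coef p != 0 by rewrite lead_coef_eq0 -size_poly_gt0 ltnW.
  have eqp_p : (lead_coef p)^-1 *: p %= p by rewrite eqp_scale ?invr_eq0.
  split; last by rewrite (eqp_dvdl _ eqp_p).
    by rewrite monicE lead_coefZ mulVf.
  split; first by rewrite (eqp_size eqp_p).
  move=> g g1; rewrite (eqp_dvdr _ eqp_p) => /(apply_irredp irr_p g1) eq_gp.
  by rewrite (eqp_trans eq_gp) // eqp_sym.
have [g [g1 g_p neq_gp]] : exists g : {poly K}, [/\ size g != 1%N, g %| p & ~~ (g %= p)].
  apply: contrapT => no_g; apply: red_p; split=> // g g1 g_p.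
  by apply: contrapT => /negP neq_gp; apply: no_g; exists g.
have p0 : p != 0 by rewrite -size_poly_gt0 ltnW.
have g0 : g != 0 by apply: contraNneq p0 => g0; rewrite g0 dvd0p in g_p.
have [||f [mf irr_f f_g]] := IHn g.
- rewrite -ltnS (leq_trans _ lt_pn) // !ltnS ltn_neqAle dvdp_leq // andbT.
  by apply: contraNneq neq_gp => eq_sz; rewrite -(dvdp_size_eqp g_p) eq_sz.
- by move: g0 g1; rewrite -size_poly_gt0; case: (size g) => [|[]].
by exists f; split=> //; apply: dvdp_trans f_g g_p.
Qed.

Lemma irreducible_dvdp_monic (K : fieldType) (f g : {poly K}) :
  f \is monic -> g \is monic -> irreducible_poly f -> irreducible_poly g ->
  (g %| f) = (g == f).
Proof.
move=> mf mg irr_f irr_g; apply/idP/eqP => [g_f|-> //].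
apply/eqP; rewrite -eqp_monic //; apply: (apply_irredp irr_f) g_f.
by rewrite gtn_eqF // irr_g.
Qed.

Section FinitePoly.
Variable F : finFieldType.
Implicit Types (p r f g : {poly F}) (n d : nat).

(** Lists, since the type of polynomials is infinite; [monics] is parametrised exactly as in [Nirr],
    which makes the counts comparable. *)
Definition polys n : seq {poly F} := map rVpoly (enum {: 'rV[F]_n}).
Definition monics n : seq {poly F} := map (fun v => 'X^n + rVpoly v) (enum {: 'rV[F]_n}).

Lemma mem_polys n p : (p \in polys n) = (size p <= n)%N.
Proof.
apply/mapP/idP => [[v _ ->]|le_pn]; first exact: size_poly.
by exists (poly_rV p); rewrite ?mem_enum // poly_rV_K.
Qed.

Lemma polys_uniq n : uniq (polys n).
Proof. by rewrite map_inj_uniq ?enum_uniq //; apply: can_inj rVpolyK. Qed.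

Lemma size_polys n : size (polys n) = (#|F| ^ n)%N.
Proof. by rewrite size_map -cardE card_mx mul1n. Qed.

Lemma mem_monics n p : (p \in monics n) = (p \is monic) && (size p == n.+1).
Proof.
apply/mapP/andP => [[v _ ->]|[mp /eqP sz_p]].
  have lt_v : (size (rVpoly v) < size ('X^n : {poly F}))%N.
    by rewrite size_polyXn ltnS size_poly.
  by rewrite monicE lead_coefDl // lead_coefXn eqxx size_polyDl // size_polyXn eqxx.
exists (poly_rV (p - 'X^n)); rewrite ?mem_enum // poly_rV_K ?subrKC //.
apply/leq_sizeP => j; rewrite coefB coefXn leq_eqVlt => /predU1P[<-|lt_nj].
  by move: mp; rewrite monicE lead_coefE sz_p eqxx => /eqP ->; rewrite subrr.
by rewrite gtn_eqF // nth_default ?sz_p // subrr.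
Qed.

Lemma monics_uniq n : uniq (monics n).
Proof.
rewrite map_inj_uniq ?enum_uniq // => u v /addrI.
exact: (can_inj rVpolyK).
Qed.

Lemma size_monics n : size (monics n) = (#|F| ^ n)%N.
Proof. by rewrite size_map -cardE card_mx mul1n. Qed.

Lemma monics0 : monics 0 = [:: 1].
Proof.
apply: perm_small_eq => //; apply: uniq_perm => // [|p]; first exact: monics_uniq.
rewrite mem_monics inE; apply/andP/eqP => [[mp /size_poly1P[c _ def_p]]|->].
  by move: mp; rewrite def_p monicE lead_coefC => /eqP ->.
by rewrite monic1 size_poly1.
Qed.

(** * The totient of a polynomial *)

(** The order of the unit group of F[X]/(p). For p = 1 the only residue is 0, which is coprime to
    1. *)
Definition totientp p := count (fun g => coprimep g p) (polys (size p).-1).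

Lemma totientp1 : totientp 1 = 1%N.
Proof.
rewrite /totientp (eq_count (a2 := predT)) => [|g]; last by rewrite coprimep1.
by rewrite count_predT size_polys size_poly1.
Qed.

(** Euclidean division by [r]: quotient and remainder exist and are unique. *)
Lemma perm_polysD d r : r != 0 ->
  perm_eq (polys (d + (size r).-1))
    [seq h * r + g | h <- polys d, g <- polys (size r).-1].
Proof.
move=> r0; apply: uniq_perm; first exact: polys_uniq.
  apply: allpairs_uniq; try exact: polys_uniq.
  move=> [h g] [h' g'] /allpairsP[[h1 g1] [_ /= g1P [-> ->]]].
  move=> /allpairsP[[h2 g2] [_ /= g2P [-> ->]]] /= eq_hg.
  have small k : k \in polys (size r).-1 -> (size k < size r)%N.
    by rewrite mem_polys -ltnS prednK ?size_poly_gt0.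
  have eq_h := congr1 (fun p => p %/ r) eq_hg.
  have eq_g := congr1 (fun p => p %% r) eq_hg.
  rewrite !divp_addl_mul_small ?small // in eq_h.
  by rewrite !modp_addl_mul_small ?small // in eq_g; rewrite eq_h eq_g.
move=> p; rewrite mem_polys; apply/idP/allpairsP => [le_p|[[h g] /= [hP gP ->]]].
  exists (p %/ r, p %% r); rewrite -divp_eq !mem_polys size_divp //=.
  by rewrite leq_subLR addnC le_p -ltnS prednK ?size_poly_gt0 // ltn_modp.
rewrite !mem_polys in hP gP.
rewrite (leq_trans (size_polyD _ _)) // geq_max (leq_trans gP) ?leq_addl // andbT.
have [->|h0] := eqVneq h 0; first by rewrite mul0r size_poly0.
rewrite size_mul //; case: (size r) (size_poly_gt0 r) => [|s _]; first by rewrite r0.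
by rewrite addnS leq_add2r.
Qed.

(** Coprimality to [r] depends only on the remainder modulo [r], and each remainder occurs with
    [#|F| ^ d] quotients. *)
Lemma count_coprimep d r : r != 0 ->
  count (fun g => coprimep g r) (polys (d + (size r).-1)) = (#|F| ^ d * totientp r)%N.
Proof.
move=> r0; rewrite (permP (perm_polysD d r0)) -sum1_count big_flatten big_map /=.
rewrite (eq_bigr (fun=> totientp r)) => [|h _].
  by rewrite big_const_seq count_predT size_polys iter_addn_0 mulnC.
rewrite big_map sum1_count; apply: eq_count => g /=.
by rewrite !(coprimep_sym _ r) coprimep_addl_mul.
Qed.

Lemma predn_size_mul p r : p != 0 -> r != 0 ->
  (size (p * r)).-1 = ((size p).-1 + (size r).-1)%N.
Proof.
move=> p0 r0; rewrite size_mul //; rewrite -!size_poly_gt0 in p0 r0.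
by rewrite -(prednK p0) -(prednK r0) addSn addnS.
Qed.

Lemma totientp_mul_dvd f r : irreducible_poly f -> r != 0 -> f %| r ->
  totientp (f * r) = (#|F| ^ (size f).-1 * totientp r)%N.
Proof.
move=> irr_f r0 f_r; rewrite -count_coprimep // /totientp.
have f0 := irredp_neq0 irr_f; rewrite predn_size_mul //; apply: eq_count => g.
rewrite coprimepMr andbC; apply: andb_idr; exact: coprimep_dvdl.
Qed.

Lemma perm_polys_dvd f n : f != 0 ->
  perm_eq [seq g <- polys ((size f).-1 + n) | f %| g] [seq f * h | h <- polys n].
Proof.
move=> f0; apply: uniq_perm; first by rewrite filter_uniq ?polys_uniq.
  by rewrite map_inj_uniq ?polys_uniq //; apply: mulfI.
have szf : (0 < size f)%N by rewrite size_poly_gt0.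
move=> g; rewrite mem_filter mem_polys; apply/andP/mapP => [[/dvdpP[h ->] le_g]|[h]].
  exists h; last by rewrite mulrC.
  rewrite mem_polys; have [->|h0] := eqVneq h 0; first by rewrite size_poly0.
  by move: le_g; rewrite size_mul // -(prednK szf) addnS /= addnC leq_add2l.
rewrite mem_polys => le_h ->; rewrite dvdp_mulr //.
have [->|h0] := eqVneq h 0; first by rewrite mulr0 size_poly0.
by rewrite size_mul // -(prednK szf) addSn /= leq_add2l.
Qed.

(** Among the residues modulo f r that are coprime to r, those prime to f number phi (f r); the
    multiples f h are coprime to r exactly when h is, and number phi r. *)
Lemma totientp_mul_ndvd f r : irreducible_poly f -> r != 0 -> ~~ (f %| r) ->
  (totientp (f * r) + totientp r = #|F| ^ (size f).-1 * totientp r)%N.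
Proof.
move=> irr_f r0 f_r; rewrite -count_coprimep // {1}/totientp.
have f0 := irredp_neq0 irr_f.
rewrite predn_size_mul // -[RHS](permP (permEl (perm_filterC (dvdp f) _))) count_cat addnC.
congr (_ + _)%N.
  rewrite (permP (perm_polys_dvd _ f0)) count_map; apply: eq_count => h /=.
  by rewrite coprimepMl (irreducible_poly_coprime _ irr_f) f_r.
rewrite count_filter; apply: eq_count => g /=.
by rewrite coprimepMr andbC (coprimep_sym g f) (irreducible_poly_coprime _ irr_f).
Qed.

Lemma perm_monics_dvd f n : f \is monic ->
  perm_eq [seq g <- monics ((size f).-1 + n) | f %| g] [seq f * h | h <- monics n].
Proof.
move=> mf; have f0 := monic_neq0 mf.
apply: uniq_perm; first by rewrite filter_uniq ?monics_uniq.
  by rewrite map_inj_uniq ?monics_uniq //; apply: mulfI.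
have szf : (0 < size f)%N by rewrite size_poly_gt0.
move=> g; rewrite mem_filter mem_monics; apply/and3P/mapP => [[/dvdpP[h ->] mhf sz_g]|[h]].
  exists h; last by rewrite mulrC.
  have mh : h \is monic by rewrite -(monicMr _ mf).
  move: sz_g; rewrite mem_monics mh size_mul ?monic_neq0 //.
  by rewrite -(prednK szf) addnS /= addnC -addnS eqn_add2l.
rewrite mem_monics => /andP[mh /eqP sz_h] ->.
rewrite dvdp_mulr // monicMr // size_mul ?monic_neq0 // sz_h.
by rewrite -(prednK szf) addSn /= addnS eqxx.
Qed.

(** * Sums of reciprocal totients *)

(** [T] collects the primes whose Euler factors are already split off; [C_GL] will be [wsum
    [:: 'X]]. *)
Definition wsum (T : seq {poly F}) : series := fun n =>
  \sum_(p <- monics n | all (fun f => ~~ (f %| p)) T) (totientp p)%:R^-1.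

Definition wsum_dvd (T : seq {poly F}) f : series := fun n =>
  \sum_(p <- monics n | all (fun f => ~~ (f %| p)) T && (f %| p)) (totientp p)%:R^-1.

Lemma eq_wsum T T' : T =i T' -> wsum T = wsum T'.
Proof.
move=> eqT; apply/funext => n; apply: eq_bigl => p.
exact: eq_all_r.
Qed.

Lemma wsum_cons T f : wsum T = ps_add (wsum_dvd T f) (wsum (f :: T)).
Proof.
apply/funext => n; rewrite /wsum (bigID (dvdp f)) /=; congr (_ + _).
by apply: eq_bigl => p; rewrite andbC.
Qed.

Lemma card_gt1 : (1 < #|F|)%N.
Proof. exact: finNzRing_gt1. Qed.

Lemma qqX_sub1_neq0 d : (0 < d)%N -> qq F ^+ d - 1 != 0.
Proof.
move=> d_gt0; rewrite subr_eq0 /qq -natrX pnatr_eq1 gtn_eqF //.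
by rewrite -(exp1n d) ltn_exp2r // card_gt1.
Qed.

(** Write p = f r. The primes of [T] differ from f, so whether they divide p depends on r alone. By
    the totient rules, an r prime to f has its weight divided by q^d - 1, and an r divisible by f
    has it divided by q^d. *)
Lemma wsum_dvd_rec T f : f \is monic -> irreducible_poly f ->
  {in T, forall g, g \is monic /\ irreducible_poly g} -> f \notin T ->
  wsum_dvd T f = ps_mul (ps_X (size f).-1)
    (ps_add (ps_scale (qq F ^+ (size f).-1 - 1)^-1 (wsum (f :: T)))
            (ps_scale (qq F ^+ (size f).-1)^-1 (wsum_dvd T f))).
Proof.
move=> mf irr_f TP fT; apply/funext => n; rewrite ps_mulXE; case: leqP => [le_dn|lt_nd].
  rewrite {1}/wsum_dvd -{1}(subnKC le_dn).
  under eq_bigl do rewrite andbC.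
  rewrite -big_filter_cond.
  rewrite (perm_big _ (perm_monics_dvd _ mf)) big_map /=.
  set m := (n - _)%N.
  rewrite /ps_add /ps_scale /wsum /wsum_dvd (bigID (dvdp f)) /= addrC !mulr_sumr.
  have allT r : all (fun g => ~~ (g %| f * r)) T = all (fun g => ~~ (g %| r)) T.
    apply: eq_in_all => g gT; have [mg irr_g] := TP g gT.
    rewrite Gauss_dvdpr // irreducible_poly_coprime // irreducible_dvdp_monic //.
    by apply: contraNneq fT => <-.
  congr (_ + _).
    rewrite [LHS]big_seq_cond [RHS]big_seq_cond.
    apply: eq_big => [r|r /and3P[]]; first by rewrite allT [_ && ~~ _]andbC.
    rewrite mem_monics => /andP[mr _] _ f_r.
    have := totientp_mul_ndvd irr_f (monic_neq0 mr) f_r.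
    move/(congr1 (fun k : nat => k%:R : rat)); rewrite natrD natrM natrX => eq_t.
    by rewrite -invfM mulrBl mul1r -eq_t addrK.
  rewrite [LHS]big_seq_cond [RHS]big_seq_cond.
  apply: eq_big => [r|r /and3P[]]; first by rewrite allT.
  rewrite mem_monics => /andP[mr _] _ f_r.
  by rewrite totientp_mul_dvd ?monic_neq0 // natrM natrX invfM.
rewrite /wsum_dvd big_seq_cond big1 // => p /and3P[].
rewrite mem_monics => /andP[mp /eqP sz_p] _ /(dvdp_leq (monic_neq0 mp)).
rewrite sz_p => le_f; move: lt_nd; rewrite ltnNge -ltnS prednK ?le_f //.
by rewrite size_poly_gt0 monic_neq0.
Qed.

(** Closed form of the sum over k >= 1 of u^(dk) / phi (f^k), for f irreducible of degree d. *)
Definition geom d : series :=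
  ps_mul (ps_X d) (ps_inv (ps_mul (ps_C (qq F ^+ d - 1)) (one_minus_uq F d))).

Lemma one_minus_uq0 d : (0 < d)%N -> one_minus_uq F d 0%N = 1.
Proof.
by case: d => // d _; rewrite /one_minus_uq /ps_add /ps_scale /ps_X /= mulr0 addr0.
Qed.

Lemma irredp_deg_gt0 f : irreducible_poly f -> (0 < (size f).-1)%N.
Proof. by case=> + _; case: (size f) => [|[]]. Qed.

(** The recursion D = u^d (W / (q^d - 1) + D / q^d) is linear in D and amounts to (q^d - 1)(1 - u^d
    / q^d) D = u^d W. *)
Lemma wsum_dvdE T f : f \is monic -> irreducible_poly f ->
  {in T, forall g, g \is monic /\ irreducible_poly g} -> f \notin T ->
  wsum_dvd T f = ps_mul (geom (size f).-1) (wsum (f :: T)).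
Proof.
move=> mf irr_f TP fT; have d_gt0 := irredp_deg_gt0 irr_f.
have eqD := wsum_dvd_rec mf irr_f TP fT.
set d := (size f).-1 in d_gt0 eqD *.
rewrite /geom (ps_mulC (ps_X d)) -ps_mulA; apply: ps_mul_eq_inv.
  rewrite ps_mulCs /ps_scale one_minus_uq0 // mulr1; exact: qqX_sub1_neq0.
rewrite -ps_mulA ps_mulCs /one_minus_uq ps_mulDl ps_mul1f ps_mulZl.
apply/funext => n; rewrite /ps_scale /ps_add {1}eqD !ps_mulXE; case: leqP => _.
  rewrite /ps_add /ps_scale mulNr addrK mulrA mulfV ?mul1r //.
  exact: qqX_sub1_neq0.
by rewrite mulr0 addr0 mulr0.
Qed.

Lemma wsum_factor T f : f \is monic -> irreducible_poly f ->
  {in T, forall g, g \is monic /\ irreducible_poly g} -> f \notin T ->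
  wsum T = ps_mul (factor F (size f).-1) (wsum (f :: T)).
Proof.
move=> mf irr_f TP fT; rewrite [LHS](wsum_cons T f) wsum_dvdE //.
rewrite /factor ps_mulDl ps_mul1f -/(geom _).
by apply/funext => n; rewrite /ps_add addrC.
Qed.

Lemma wsum_factor_seq T L d : {in L, forall g, g \in monics d /\ irreducible_poly g} ->
  {in T, forall g, g \is monic /\ irreducible_poly g} -> uniq L ->
  ~~ has (mem T) L ->
  wsum T = ps_mul (ps_pow (factor F d) (size L)) (wsum (L ++ T)).
Proof.
elim: L T => [|f L IHL] T LP TP /=; first by rewrite ps_mul1f.
case/andP=> fL uL; rewrite negb_or => /andP[fT LT].
have [] := LP f (mem_head _ _); rewrite mem_monics => /andP[mf /eqP szf] irr_f.
rewrite (wsum_factor mf irr_f TP fT) szf /=.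
rewrite (IHL (f :: T)) => [|g gL|g|//|].
- rewrite -ps_mulA; congr (ps_mul _ (ps_mul _ _)); apply: eq_wsum => g.
  by rewrite !(inE, mem_cat) orbCA.
- by apply: LP; rewrite inE gL orbT.
- by rewrite inE => /predU1P[-> //|/TP].
- apply: contra LT => /hasP[g gL]; rewrite inE => /predU1P[eq_g|gT].
    by rewrite -eq_g gL in fL.
  by apply/hasP; exists g.
Qed.

(** * Euler products over irreducible polynomials *)

Definition irreds (T : seq {poly F}) d : seq {poly F} :=
  [seq f <- monics d | `[< irreducible_poly f >] && (f \notin T)].

Definition irreds_upto T n := flatten [seq irreds T d | d <- iota 1 n].

Lemma mem_irreds T d f : reflect
  [/\ f \is monic, size f = d.+1, irreducible_poly f & f \notin T] (f \in irreds T d).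
Proof.
rewrite mem_filter mem_monics; apply: (iffP and3P).
  by case=> /andP[/asboolP ? ?] ? /eqP.
by case=> mf szf /asboolP irr_f fT; rewrite irr_f fT mf szf eqxx.
Qed.

Lemma mem_irreds_upto T n f : reflect
  [/\ f \is monic, (1 < size f <= n.+1)%N, irreducible_poly f & f \notin T]
  (f \in irreds_upto T n).
Proof.
apply: (iffP flatten_mapP) => [[d]|[mf /andP[f_gt1 f_le] irr_f fT]].
  by rewrite mem_iota add1n ltnS => lt_d /mem_irreds[? -> ? ?].
exists (size f).-1; last by apply/mem_irreds; rewrite prednK // ltnW.
by rewrite mem_iota add1n ltnS; case: (size f) f_gt1 f_le => [|[]].
Qed.

Lemma wsum_prod T n : {in T, forall g, g \is monic /\ irreducible_poly g} ->
  wsum T = ps_mul (\big[ps_mul/ps1]_(1 <= d < n.+1) ps_pow (factor F d) (size (irreds T d)))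
                  (wsum (irreds_upto T n ++ T)).
Proof.
move=> TP; elim: n => [|n IHn]; first by rewrite big_geq // ps_mul1f.
rewrite big_nat_recr //= {1}IHn -ps_mulA; congr (ps_mul _ _).
rewrite (@wsum_factor_seq _ (irreds T n.+1) n.+1).
- congr (ps_mul _ _); apply: eq_wsum => g; rewrite /irreds_upto.
  have -> : iota 1 n.+1 = iota 1 n ++ [:: n.+1] by rewrite -[in LHS](addn1 n) iotaD add1n.
  by rewrite map_cat flatten_cat /= cats0 !mem_cat orbCA orbA.
- by move=> g /mem_irreds[mg szg irr_g _]; rewrite mem_monics mg szg eqxx.
- by move=> g; rewrite mem_cat => /orP[/mem_irreds_upto[]|/TP].
- by rewrite filter_uniq ?monics_uniq.
apply/hasPn => g /mem_irreds[mg szg irr_g gT]; rewrite /= mem_cat negb_or gT andbT.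
by apply/negP => /mem_irreds_upto[_]; rewrite szg ltnn andbF.
Qed.

(** A nonconstant monic p of degree at most n has an irreducible divisor of degree at most n, which
    is on the list; only p = 1 survives. *)
Lemma wsum_irreds_upto T n k : {in T, forall g, g \is monic /\ irreducible_poly g} ->
  (k <= n)%N -> wsum (irreds_upto T n ++ T) k = ps1 k.
Proof.
move=> TP; case: k => [_|k le_kn]; rewrite /wsum.
  rewrite monics0 big_cons big_nil; case: allP => [_|[]].
    by rewrite totientp1 invr1 addr0.
  have irr1 g : irreducible_poly g -> ~~ (g %| 1).
    by case=> g1 _; apply/negP => /dvdp_leq; rewrite oner_eq0 size_poly1 leqNgt g1 => /(_ isT).
  by move=> g; rewrite mem_cat => /orP[/mem_irreds_upto[_ _]|/TP[_]] /irr1.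
rewrite big_seq_cond big1 // => p /andP[]; rewrite mem_monics => /andP[mp /eqP szp] /allP pT.
have [|f [mf irr_f f_p]] := @irreducible_divisor _ p; first by rewrite szp.
have fT : f \in irreds_upto T n ++ T.
  rewrite mem_cat; have [|fT] := boolP (f \in T); rewrite ?orbT // orbF.
  apply/mem_irreds_upto; split=> //; rewrite irr_f.
  by rewrite (leq_trans (dvdp_leq (monic_neq0 mp) f_p)) // szp.
by have := pT f fT; rewrite f_p.
Qed.

Lemma wsum_infprod T : {in T, forall g, g \is monic /\ irreducible_poly g} ->
  wsum T = ps_infprod (fun d => ps_pow (factor F d) (size (irreds T d))).
Proof.
move=> TP; apply/funext => n; rewrite (wsum_prod n TP) ps_mul_eq1_trunc // => k.
exact: wsum_irreds_upto.
Qed.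

Lemma monics1_irreducible f : f \in monics 1 -> irreducible_poly f.
Proof.
case/mapP=> v _ ->; have /size1_polyC-> := size_poly _ _ : (size (rVpoly v) <= 1)%N.
exact: irredp_XaddC.
Qed.

Lemma mem_monics1_XsubC (a : F) : 'X - a%:P \in monics 1.
Proof. by rewrite mem_monics monicXsubC size_XsubC. Qed.

(** Both excluded primes have degree 1. In degree 1 all q monic polynomials are irreducible, which
    leaves q - 2; the other degrees lose nothing. *)
Lemma size_irreds d : size (irreds [:: 'X - 1; 'X] d) = Nprime F d.
Proof.
have TE : [:: 'X - 1; 'X] = [seq 'X - a%:P | a : F <- [:: 1; 0]].
  by rewrite /= polyC1 subr0.
have Tmem f : f \in [:: 'X - 1; 'X] -> f \in monics 1.
  by rewrite TE => /mapP[a _ ->]; apply: mem_monics1_XsubC.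
rewrite /Nprime; case: eqP => [->|/eqP d1]; last first.
  rewrite /Nirr /irreds -sum1dep_card size_filter -sum1_count.
  rewrite big_map big_enum_cond.
  apply: eq_bigl => v; rewrite andTb andb_idr // => _; apply/negP => /Tmem.
  have : 'X^d + rVpoly v \in monics d by apply/mapP; exists v; rewrite ?mem_enum.
  by rewrite !mem_monics => /andP[_ /eqP ->] /andP[_]; rewrite eqSS (negPf d1).
rewrite -[#|F|]expn1 -size_monics size_filter.
rewrite (_ : count _ _ = count (predC (mem [:: 'X - 1; 'X])) (monics 1)); last first.
  by apply: eq_in_count => f /monics1_irreducible/asboolP ->.
rewrite -(count_predC (mem [:: 'X - 1; 'X])) addnC -[X in (_ + X - _)%N]size_filter.
rewrite (perm_size (_ : perm_eq _ [:: 'X - 1; 'X])) ?addnK //.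
apply: uniq_perm; first by rewrite filter_uniq ?monics_uniq.
  rewrite TE map_inj_uniq; first by rewrite /= inE oner_eq0.
  by move=> a b /addrI/oppr_inj/polyC_inj.
by move=> f; rewrite mem_filter andb_idr // => /Tmem.
Qed.

End FinitePoly.

(** * Cyclic vectors *)

Section Krylov.
Variables (F : finFieldType) (n : nat).
Implicit Types (A : 'M[F]_n.+1) (w u : 'rV[F]_n.+1) (f g p : {poly F}).

Definition krylov A w : 'M[F]_n.+1 := \matrix_(i < n.+1) (w *m A ^+ i).

(** Reading [u] as a coefficient list identifies the left kernel of the Krylov matrix with the
    polynomials of degree at most n annihilating [w]. *)
Lemma mulmx_krylov A w u : u *m krylov A w = w *m horner_mx A (rVpoly u).
Proof.
rewrite horner_rVpoly (mulmx_sum_row u) (mulmx_sum_row u) linear_sum mulmx_sumr.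
by apply: eq_bigr => i _; rewrite linearZ /= !rowK mxvecK scalemxAr.
Qed.

Lemma mulmx_hornerM A w f g :
  w *m horner_mx A (f * g) = w *m horner_mx A f *m horner_mx A g.
Proof. by rewrite rmorphM -mulmxE mulmxA. Qed.

Lemma krylov_horner A w g :
  krylov A (w *m horner_mx A g) = krylov A w *m horner_mx A g.
Proof.
apply/row_matrixP => i; rewrite row_mul !rowK -!mulmxA; congr (_ *m _).
by rewrite -[A in A ^+ i]horner_mx_X -rmorphXn !mulmxE -!rmorphM mulrC.
Qed.

Lemma krylov0 A : krylov A 0 = 0.
Proof. by apply/row_matrixP => i; rewrite rowK mul0mx row0. Qed.

Lemma krylov_horner_eq0 A w g : krylov A w \in unitmx ->
  w *m horner_mx A g = 0 -> horner_mx A g = 0.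
Proof.
move=> uK wg0; rewrite -[LHS](mulKmx uK) -krylov_horner wg0 krylov0.
by rewrite mulmx0.
Qed.

Lemma krylov_small_eq0 A w g : krylov A w \in unitmx ->
  w *m horner_mx A g = 0 -> (size g <= n.+1)%N -> g = 0.
Proof.
move=> uK wg0 le_g; rewrite -(poly_rV_K le_g) in wg0 *.
move: wg0; rewrite -mulmx_krylov => /(congr1 (mulmx^~ (invmx (krylov A w)))).
by rewrite mulmxK // mul0mx => ->; rewrite linear0.
Qed.

(** The minimal polynomial divides p, and the independence of the w A^i for i <= n keeps its degree
    from being smaller. *)
Lemma krylov_minpoly A w p : krylov A w \in unitmx -> p \is monic ->
  size p = n.+2 -> horner_mx A p = 0 -> mxminpoly A = p.
Proof.
move=> uK mp szp pA0; have m_p := mxminpoly_min pA0.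
apply/eqP; rewrite -eqp_monic ?mxminpoly_monic // -dvdp_size_eqp // szp.
rewrite eqn_leq -{1}szp dvdp_leq ?monic_neq0 //= ltnNge; apply/negP => le_m.
have/eqP := monic_neq0 (mxminpoly_monic A); apply.
by apply: krylov_small_eq0 uK _ le_m; rewrite mx_root_minpoly mulmx0.
Qed.

Lemma krylov_cyclic A w : krylov A w \in unitmx -> cyclicmx A.
Proof.
move=> uK; apply/eqP; apply: (krylov_minpoly uK (char_poly_monic A)).
  by rewrite size_char_poly.
exact: Cayley_Hamilton.
Qed.

Lemma mulmx_horner_coprime A w f g : coprimep f g ->
  w *m horner_mx A f = 0 -> w *m horner_mx A g = 0 -> w = 0.
Proof.
case/Bezout_eq1_coprimepP => -[a b] /= ab1 wf wg.
rewrite -[w]mulmx1 -[1%:M]/(1 : 'M_n.+1) -(rmorph1 (horner_mx A)) -ab1.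
rewrite rmorphD mulmxDr mulrC (mulrC b) !mulmx_hornerM wf wg.
by rewrite !mul0mx addr0.
Qed.

Lemma mulmx_horner_dvd A w f g : f %| g ->
  w *m horner_mx A f = 0 -> w *m horner_mx A g = 0.
Proof.
by move=> /dvdpP[h ->] wf; rewrite mulrC mulmx_hornerM wf mul0mx.
Qed.

Lemma exists_mulmx_neq0 (M : 'M[F]_n.+1) : M != 0 -> exists w : 'rV_n.+1, w *m M != 0.
Proof.
move=> M0; apply: contrapT => no_w; case/negP: M0; apply/eqP/row_matrixP => i.
rewrite row0 rowE; apply/eqP; apply: contrapT => /negP wM.
by apply: no_w; exists (delta_mx 0 i).
Qed.

(* For [v] good for the primes in [L] and [w] good for [f], the vector
   [v f(A) + w (prod L)(A)] is good for [f :: L]: each summand is killed at the primes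
   of the other one, and coprimality keeps it alive at its own. *)
Lemma good_vector A (L : seq {poly F}) : uniq L ->
  {in L, forall f, [/\ f \is monic, irreducible_poly f & f %| mxminpoly A]} ->
  exists v : 'rV_n.+1, {in L, forall f, v *m horner_mx A (mxminpoly A %/ f) != 0}.
Proof.
set m := mxminpoly A; have mm : m \is monic := mxminpoly_monic A.
elim: L => [|f L IHL] /= => [_ _|/andP[fL uL] LP]; first by exists 0.
have [|v vL] := IHL uL; first by move=> g gL; apply: LP; rewrite inE gL orbT.
have [mf irr_f f_m] := LP f (mem_head _ _).
have killed g w : g %| m -> w *m horner_mx A (m %/ g) *m horner_mx A g = 0.
  by move=> g_m; rewrite -mulmx_hornerM divpK // mx_root_minpoly mulmx0.
have [w wf] : exists w : 'rV_n.+1, w *m horner_mx A (m %/ f) != 0.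
  apply: exists_mulmx_neq0; apply: contraTneq isT => /mxminpoly_min /dvdp_leq.
  rewrite -/m dvdp_div_eq0 // monic_neq0 // size_divp ?monic_neq0 // => /(_ isT).
  rewrite leqNgt ltn_subrL size_poly_gt0 monic_neq0 // andbT.
  by rewrite irredp_deg_gt0.
pose P := \prod_(g <- L) g.
exists (v *m horner_mx A f + w *m horner_mx A P) => h.
have swap u a b : u *m horner_mx A a *m horner_mx A b = u *m horner_mx A b *m horner_mx A a.
  by rewrite -!mulmx_hornerM mulrC.
rewrite inE mulmxDl => /predU1P[->|]; last move: h => g gL.
  rewrite swap killed // add0r swap; apply: contraNneq wf => wP0; apply/eqP.
  apply: (mulmx_horner_coprime _ (killed f w f_m) wP0).
  rewrite /P big_seq; elim/big_ind: _ => [|a b fa fb|g gL]; first exact: coprimep1.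
    by rewrite coprimepMr fa.
  have [mg irr_g _] : [/\ g \is monic, irreducible_poly g & g %| m].
    by apply: LP; rewrite inE gL orbT.
  rewrite irreducible_poly_coprime // irreducible_dvdp_monic //.
  by apply: contraNneq fL => ->.
have [mg irr_g g_m] : [/\ g \is monic, irreducible_poly g & g %| m].
  by apply: LP; rewrite inE gL orbT.
rewrite [X in _ + X](_ : _ = 0) ?addr0; last first.
  rewrite swap; apply: mulmx_horner_dvd (killed g w g_m).
  by rewrite /P (big_rem g) //= dvdp_mulr.
rewrite swap; apply: contraNneq (vL g gL) => vg0; apply/eqP.
apply: (mulmx_horner_coprime _ (killed g v g_m) vg0).
rewrite irreducible_poly_coprime // irreducible_dvdp_monic //.
by apply: contraNneq fL => <-.
Qed.

(** Take v good at every prime divisor of the minimal polynomial m. No proper divisor of m then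
    annihilates v, so no nonzero polynomial of degree below deg m = n + 1 does. *)
Lemma cyclic_krylov A : cyclicmx A -> exists w, krylov A w \in unitmx.
Proof.
move=> /eqP cycA; set m := mxminpoly A in cycA *.
have szm : size m = n.+2 by rewrite cycA size_char_poly.
have mm : m \is monic := mxminpoly_monic A.
have m0 := monic_neq0 mm.
pose L := undup [seq f <- irreds_upto [::] n.+1 | f %| m].
have LP f : reflect [/\ f \is monic, irreducible_poly f & f %| m] (f \in L).
  rewrite mem_undup mem_filter; apply: (iffP andP).
    by case=> f_m /mem_irreds_upto[].
  case=> mf irr_f f_m; split=> //; apply/mem_irreds_upto; split=> //.
  by rewrite irr_f -szm dvdp_leq.
have [||v vL] := @good_vector A L; [exact: undup_uniq|by move=> f /LP|].
exists v; rewrite -row_free_unit -kermx_eq0; apply/eqP/row_matrixP => i; rewrite row0.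
set u := row i _.
have : u *m krylov A v = 0 by rewrite -row_mul mulmx_ker row0.
rewrite mulmx_krylov => vu0; apply: contrapT => /eqP u0.
(* By Bezout the gcd of u and m also annihilates v, and its degree is below that of m. *)
pose k := gcdp (rVpoly u) m.
have vk0 : v *m horner_mx A k = 0.
  have [[a b] /= /andP[/mulmx_horner_dvd comb_k _]] := Bezoutp (rVpoly u) m.
  apply: comb_k.
  rewrite rmorphD mulmxDr mulrC (mulrC b) !mulmx_hornerM vu0 mx_root_minpoly.
  by rewrite mulmx0 !mul0mx addr0.
have k_m : k %| m := dvdp_gcdr _ _.
have ru0 : rVpoly u != 0.
  by apply: contraNneq u0 => ru0; rewrite -[u]rVpolyK ru0 linear0.
have szk : (size k < size m)%N.
  rewrite szm ltnS (leq_trans (dvdp_leq ru0 (dvdp_gcdl _ _))) //; exact: size_poly.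
(* For a prime f dividing m / k, k divides m / f; so m / f annihilates v, against the choice of
   v. *)
have [|f [mf irr_f f_mk]] := @irreducible_divisor _ (m %/ k).
  have k0 : k != 0 by apply: contraNneq m0 => k0; rewrite k0 dvd0p in k_m.
  rewrite size_divp // ltn_subRL addn1 prednK ?size_poly_gt0 //.
have f_m : f %| m by rewrite -(divpK k_m) dvdp_mulr.
have /negP := vL f (introT (LP f) (And3 mf irr_f f_m)); case; apply/eqP.
apply: mulmx_horner_dvd vk0.
have f0 := monic_neq0 mf.
by rewrite -(dvdp_mul2r _ _ f0) divpK // -[X in _ %| X](divpK k_m) [k * f]mulrC dvdp_mul.
Qed.

End Krylov.

(** * Counting cyclic matrices *)

Section CountCyclic.
Variables (F : finFieldType) (n : nat).
Implicit Types (A : 'M[F]_n.+1) (w u : 'rV[F]_n.+1) (f g p : {poly F}).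

Definition GLset : {set 'M[F]_n.+1} := [set A | A \in unitmx].

(** Bezout and Cayley-Hamilton give one direction. Conversely, let k be the gcd of g and p: g(A) (p
    / k)(A) is a multiple of p(A) = 0, so an invertible g(A) forces (p / k)(A) = 0. For nonconstant
    k this is impossible, as p / k has degree at most n. *)
Lemma unitmx_horner A w g : krylov A w \in unitmx ->
  (horner_mx A g \in unitmx) = coprimep g (char_poly A).
Proof.
move=> uK; set p := char_poly A; apply/idP/idP => [ug|]; last first.
  case/Bezout_eq1_coprimepP => -[a b] /= ab1.
  suff /mulmx1_unit[]: horner_mx A a *m horner_mx A g = 1%:M by [].
  have := congr1 (horner_mx A) ab1.
  by rewrite rmorphD rmorphM rmorphM /= Cayley_Hamilton mulr0 addr0 rmorph1.
have p0 : p != 0 by rewrite monic_neq0 ?char_poly_monic.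
apply: contraT => g_p; pose k := gcdp g p.
have k_p : k %| p := dvdp_gcdr _ _.
have k0 : k != 0 by apply: contraNneq p0 => k0; rewrite k0 dvd0p in k_p.
have pk0 : horner_mx A (p %/ k) = 0.
  apply: (can_inj (mulKmx ug)); rewrite mulmx0 mulmxE -rmorphM.
  have k_g : k %| g := dvdp_gcdl _ _.
  rewrite -{1}(divpK k_g) -mulrA (mulrC k) divpK // rmorphM.
  by rewrite /= Cayley_Hamilton mulr0.
have pk : p %/ k = 0.
  apply: (krylov_small_eq0 uK); first by rewrite pk0 mulmx0.
  rewrite size_divp // size_char_poly leq_subLR addnS ltnS -add1n leq_add2r.
  by move: g_p k0; rewrite /coprimep -/k -size_poly_gt0; case: (size k) => [|[]].
by rewrite -(divpK k_p) pk mul0r eqxx in p0.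
Qed.

(** Every row vector is w g(A) for exactly one g of degree at most n, and its Krylov matrix is that
    of w times g(A). *)
Lemma card_cyclic_vectors A w : krylov A w \in unitmx ->
  #|[set u | krylov A u \in unitmx]| = totientp (char_poly A).
Proof.
move=> uK.
have -> : [set u | krylov A u \in unitmx] =
    [set u *m krylov A w | u in [set u | coprimep (rVpoly u) (char_poly A)]].
  apply/setP => v; rewrite inE; apply/idP/imsetP => [uv|[u]].
    exists (v *m invmx (krylov A w)); last by rewrite mulmxKV.
    rewrite inE -(unitmx_horner _ uK); move: uv.
    rewrite -{1}(mulmxKV uK v) mulmx_krylov krylov_horner unitmx_mul uK /=.
    by [].
  rewrite inE -(unitmx_horner _ uK) => uu ->.
  by rewrite mulmx_krylov krylov_horner unitmx_mul uK.
rewrite card_imset; last exact: can_inj (mulmxK uK).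
rewrite /totientp size_char_poly count_map -sum1_count big_enum_cond.
by rewrite -sum1dep_card.
Qed.

(* [v] lists the lower coefficients of [p = 'X^(n.+1) + rVpoly v]; a Krylov matrix [P] of [A]
   determines [A] by [P *m A = shift_mx v P]. *)
Definition shift_mx (v : 'rV[F]_n.+1) (P : 'M[F]_n.+1) : 'M[F]_n.+1 :=
  \matrix_(i < n.+1) if (i.+1 < n.+1)%N then row (inord i.+1) P else - (v *m P).

Lemma horner_mx_monic A (v : 'rV[F]_n.+1) w :
  w *m horner_mx A ('X^(n.+1) + rVpoly v) = w *m A ^+ n.+1 + v *m krylov A w.
Proof. by rewrite rmorphD rmorphXn /= horner_mx_X mulmxDr mulmx_krylov. Qed.

Lemma krylov_shift A w v : horner_mx A ('X^(n.+1) + rVpoly v) = 0 ->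
  krylov A w *m A = shift_mx v (krylov A w).
Proof.
move=> pA0; apply/row_matrixP => i; rewrite row_mul !rowK -mulmxA mulmxE -exprSr.
case: ltnP => [lt_i|le_i]; first by rewrite inordK.
have -> : i.+1 = n.+1 by apply/eqP; rewrite eqn_leq ltn_ord.
by apply/eqP; rewrite -addr_eq0 -horner_mx_monic pA0 mulmx0.
Qed.

(** By the shift, the rows of [P] are w, w A, ..., w A^n for w its first row. The last row of the
    shift makes p annihilate w, hence A; so p is the minimal and the characteristic polynomial. *)
Lemma krylov_of_shift (v : 'rV[F]_n.+1) P : P \in unitmx ->
  let A := invmx P *m shift_mx v P in
  krylov A (row ord0 P) = P /\ char_poly A = 'X^(n.+1) + rVpoly v.
Proof.
move=> uP A; have PA : P *m A = shift_mx v P by rewrite mulmxA mulmxV // mul1mx.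
have rowP (i : nat) : (i < n.+1)%N -> row ord0 P *m A ^+ i = row (inord i) P.
  elim: i => [_|i IHi lt_i].
    by rewrite expr0 mulmx1; congr (row _ _); apply: val_inj; rewrite /= inordK.
  rewrite exprSr -mulmxE mulmxA IHi 1?ltnW // -row_mul PA rowK.
  by rewrite (inordK (ltnW lt_i)) lt_i.
have KP : krylov A (row ord0 P) = P.
  by apply/row_matrixP => i; rewrite rowK rowP // inord_val.
split=> //; have uK : krylov A (row ord0 P) \in unitmx by rewrite KP.
have /eqP <- := krylov_cyclic uK.
have : 'X^(n.+1) + rVpoly v \in monics F n.+1 by apply/mapP; exists v; rewrite ?mem_enum.
rewrite mem_monics => /andP[mp /eqP szp].
apply: (krylov_minpoly uK) => //; apply: (krylov_horner_eq0 uK).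
rewrite horner_mx_monic KP exprSr -mulmxE mulmxA rowP // -row_mul PA rowK inordK //.
by rewrite ltnn addNr.
Qed.

Lemma card_cyclic_pairs p : p \in monics F n.+1 ->
  #|[set x : 'M[F]_n.+1 * 'rV[F]_n.+1 |
      (char_poly x.1 == p) && (krylov x.1 x.2 \in unitmx)]| = #|GLset|.
Proof.
case/mapP=> v _ ->; set S := [set x | _].
have -> : GLset = [set krylov x.1 x.2 | x in S].
  apply/setP => P; rewrite inE; apply/idP/imsetP => [uP|[x]]; last first.
    by rewrite inE => /andP[_ uK] ->.
  have [KP cA] := krylov_of_shift v uP.
  exists (invmx P *m shift_mx v P, row ord0 P) => //.
  by rewrite inE /= cA eqxx KP.
(* Injectivity: w is the first row of its Krylov matrix K, and A is [invmx K *m shift_mx v K]. *)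
rewrite card_in_imset // => -[A w] [A' w']; rewrite !inE /=.
move=> /andP[/eqP cA uK] /andP[/eqP cA' uK'] eqK.
have := congr1 (row ord0) eqK; rewrite !rowK /= !expr0 !mulmx1 => ->.
have /(krylov_shift w) KA : horner_mx A ('X^(n.+1) + rVpoly v) = 0.
  by rewrite -cA Cayley_Hamilton.
have /(krylov_shift w') KA' : horner_mx A' ('X^(n.+1) + rVpoly v) = 0.
  by rewrite -cA' Cayley_Hamilton.
by congr (_, _); rewrite -[A](mulKmx uK) KA eqK -KA' mulKmx.
Qed.

(** Count the pairs by their matrix: a cyclic A occurs phi p times, a noncyclic one never. *)
Lemma card_cyclic_char_poly p : p \in monics F n.+1 ->
  (#|[set A : 'M[F]_n.+1 | cyclicmx A && (char_poly A == p)]| * totientp p = #|GLset|)%N.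
Proof.
move=> mp; rewrite -(card_cyclic_pairs mp) -[RHS]sum1dep_card -sum_nat_cond_const.
rewrite -(pair_big_dep (fun A => char_poly A == p)
           (fun A w => krylov A w \in unitmx) (fun _ _ => 1%N)) /=.
rewrite [RHS](bigID (@cyclicmx F n)) /= [X in (_ + X)%N]big1 ?addn0 => [|A /andP[_ cA]].
  apply: eq_big => [A|A]; first by rewrite andbC.
  move=> /andP[/cyclic_krylov[w uK] /eqP <-].
  by rewrite sum1dep_card (card_cyclic_vectors uK).
by rewrite big1 // => w /krylov_cyclic; rewrite (negPf cA).
Qed.

Lemma card_GLset_gt0 : (0 < #|GLset|)%N.
Proof. by apply/card_gt0P; exists 1%:M; rewrite inE unitmx1. Qed.

(** [Q] will be primality to X for GL, and in addition divisibility by X - 1 for the affine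
    group. *)
Lemma card_cyclic (Q : pred {poly F}) :
  (#|[set A : 'M[F]_n.+1 | cyclicmx A && Q (char_poly A)]|%:R : rat) =
  #|GLset|%:R * \sum_(p <- monics F n.+1 | Q p) (totientp p)%:R^-1.
Proof.
transitivity (\sum_(p <- monics F n.+1 | Q p)
    #|[set A : 'M[F]_n.+1 | cyclicmx A && (char_poly A == p)]|%:R : rat); last first.
  rewrite mulr_sumr big_seq_cond [RHS]big_seq_cond; apply: eq_bigr => p /andP[mp _].
  have := card_cyclic_char_poly mp; have := card_GLset_gt0.
  move=> + eqG; rewrite -eqG muln_gt0 => /andP[_ t_gt0].
  by rewrite natrM mulfK // pnatr_eq0 -lt0n.
rewrite -natr_sum; congr _%:R.
under [RHS]eq_bigr do rewrite -sum1dep_card.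
rewrite (exchange_big_dep (fun A => cyclicmx A && Q (char_poly A))) /=; last first.
  by move=> p A Qp /andP[-> /eqP ->].
rewrite -sum1dep_card; apply: eq_bigr => A /andP[cA QA].
rewrite sum1_count (eq_count (a2 := pred1 (char_poly A))) => [|p /=].
  by rewrite count_uniq_mem ?monics_uniq // mem_monics char_poly_monic size_char_poly eqxx.
by rewrite cA eq_sym andbC; case: eqP => // ->.
Qed.

End CountCyclic.

(** * Generating functions *)

Lemma unitmx_char_poly (F : fieldType) n (A : 'M[F]_n.+1) :
  (A \in unitmx) = ~~ ('X %| char_poly A).
Proof.
rewrite -['X]subr0 dvdp_XsubCl /root horner_coef0 char_poly_det.
by rewrite mulf_eq0 signr_eq0 /= unitmxE unitfE.
Qed.

Lemma cGL_wsum (F : finFieldType) : C_GL F = wsum [:: 'X : {poly F}].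
Proof.
apply/funext => -[|n] /=.
  (* Only p = 1 contributes in degree 0, and 1 / phi 1 agrees with the convention for [cGL]. *)
  by rewrite /wsum monics0 big_cons big_nil /= dvdp1 size_polyX totientp1 invr1 addr0.
rewrite /C_GL /= -/(GLset F n).
transitivity (#|[set A : 'M[F]_n.+1 | cyclicmx A && ~~ ('X %| char_poly A)]|%:R
                / #|GLset F n|%:R : rat).
  congr (_%:R / _); apply: eq_card => A; rewrite !inE andbC.
  by rewrite unitmx_char_poly.
rewrite (card_cyclic n (fun p => ~~ ('X %| p))) mulrC mulKf.
  by apply: eq_bigl => p /=; rewrite andbT.
by rewrite pnatr_eq0 -lt0n card_GLset_gt0.
Qed.

(** [eigenvalue] concerns row vectors while the affine group fixes a column; transposition passes
    between the two. *)
Lemma char_poly_tr (R : comNzRingType) n (A : 'M[R]_n) : char_poly A^T = char_poly A.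
Proof.
rewrite /char_poly -det_tr; congr (\det _).
by apply/matrixP => i j; rewrite !mxE eq_sym.
Qed.

(** * The affine group as a stabiliser *)

Section Affine.
Variables (F : finFieldType) (n : nat).
Implicit Types (x g : 'M[F]_n.+1) (v : 'cV[F]_n.+1).

Let e : 'cV[F]_n.+1 := delta_mx ord0 ord0.

(** The first column of x is [x *m e]; the stabiliser form makes orbit counting available. *)
Lemma mem_Aff x : (x \in Aff F n) = (x \in unitmx) && (x *m e == e).
Proof.
rewrite inE -colE; congr (_ && _); apply/andP/eqP => [[/eqP x1 /forallP x0]|eq_e].
  apply/colP => j; rewrite !mxE eqxx andbT.
  have [->|j0] := eqVneq j ord0; first by rewrite x1.
  by apply/eqP; apply: (implyP (x0 j)).
have xE j : x j ord0 = (j == ord0)%:R.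
  by have := congr1 (fun v : 'cV_n.+1 => v j ord0) eq_e; rewrite !mxE eqxx andbT.
by rewrite xE !eqxx; split=> //; apply/forallP => j; apply/implyP => /negPf j0; rewrite xE j0.
Qed.

Lemma e_neq0 : e != 0.
Proof. by apply/eqP => /matrixP/(_ ord0 ord0)/eqP; rewrite !mxE eqxx oner_eq0. Qed.

Lemma unitmx_col_transitive v : v != 0 -> exists2 g, g \in unitmx & g *m e = v.
Proof.
move=> v0; have e1 : e^T *m e = 1%:M.
  by rewrite trmx_delta mul_delta_mx; apply/matrixP => i j; rewrite !ord1 !mxE.
(* [e *m v^T] sends the row e^T to v^T and keeps its rank, so an invertible matrix agrees with it on
   e^T; the transpose of that matrix sends e to v. *)
have [|g ug eg] := @complete_unitmx _ _ _ e^T (e *m v^T).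
  rewrite mulmxA e1 mul1mx !rank_rV trmx_eq0 v0 trmx_eq0.
  by rewrite e_neq0.
exists g^T; rewrite ?unitmx_tr // -[e]trmxK -trmx_mul -eg.
by rewrite mulmxA e1 mul1mx trmxK.
Qed.

Definition nzcol : {set 'cV[F]_n.+1} := [set v | v != 0].

Lemma card_nzcol_gt0 : (0 < #|nzcol|)%N.
Proof.
by apply/card_gt0P; exists e; rewrite inE e_neq0.
Qed.

(** Orbit and stabiliser: the matrices of GL taking e to v form a left coset of the affine group. *)
Lemma card_Aff : (#|Aff F n| * #|nzcol| = #|GLset F n|)%N.
Proof.
rewrite mulnC -sum_nat_const -[RHS]sum1_card.
rewrite (partition_big (fun x => x *m e) (fun v => v \in nzcol)) /=; last first.
  move=> x; rewrite !inE => ux; apply: contraNneq e_neq0 => xe0.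
  by rewrite -[e](mulKmx ux) xe0 mulmx0.
apply: eq_bigr => v; rewrite inE => /unitmx_col_transitive[g ug def_v].
rewrite -sum1_card [RHS](reindex_onto (fun x => g *m x) (fun x => invmx g *m x)) /=.
  apply: eq_bigl => x; rewrite mem_Aff inE unitmx_mul ug mulKmx // eqxx andbT.
  by rewrite -mulmxA -def_v (inj_eq (can_inj (mulKmx ug))).
by move=> x _; rewrite mulKVmx.
Qed.

Lemma krylov_conj x g w : g \in unitmx ->
  krylov (invmx g *m x *m g) (w *m g) = krylov x w *m g.
Proof.
move=> ug; have conjX i : (invmx g *m x *m g) ^+ i = invmx g *m x ^+ i *m g.
  elim: i => [|i IHi]; first by rewrite !expr0 mulmx1 mulVmx.
  rewrite exprS IHi -mulmxE [in RHS]exprS -mulmxE !mulmxA.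
  by rewrite -(mulmxA _ g) mulmxV // mulmx1.
by apply/row_matrixP => i; rewrite row_mul !rowK conjX !mulmxA mulmxK.
Qed.

Lemma cyclicmx_conj x g : g \in unitmx -> cyclicmx (invmx g *m x *m g) = cyclicmx x.
Proof.
move=> ug; apply/idP/idP => /cyclic_krylov[w uK].
  apply: (@krylov_cyclic _ _ _ (w *m invmx g)); move: uK.
  by rewrite -{1}(mulmxKV ug w) krylov_conj // unitmx_mul ug andbT.
by apply: (@krylov_cyclic _ _ _ (w *m g)); rewrite krylov_conj // unitmx_mul uK.
Qed.

(** For a cyclic vector w and x v = v, all w x^i v equal w v, so this scalar determines v and the
    fixed space has dimension at most 1. The root 1 of the characteristic polynomial makes it
    exactly 1. *)
Lemma card_fixed x : cyclicmx x -> ('X - 1) %| char_poly x ->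
  #|[set v in nzcol | x *m v == v]| = #|F|.-1.
Proof.
move=> /cyclic_krylov[w uK] x1.
have inj v v' : x *m v = v -> x *m v' = v' -> w *m v = w *m v' -> v = v'.
  move=> xv xv' wv; apply: (can_inj (mulKmx uK)); apply/row_matrixP => i.
  have powx u j : x *m u = u -> x ^+ j *m u = u.
    by move=> xu; elim: j => [|j IHj]; rewrite ?mul1mx // exprS -mulmxE -mulmxA IHj.
  by rewrite !row_mul !rowK -!mulmxA !powx.
have [v0 nz_v0 xv0] : exists2 v0 : 'cV[F]_n.+1, v0 != 0 & x *m v0 = v0.
  have : eigenvalue x^T 1.
    by rewrite eigenvalue_root_char char_poly_tr -dvdp_XsubCl polyC1.
  case/eigenvalueP=> u; rewrite scale1r => xu nz_u; exists u^T; first by rewrite trmx_eq0.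
  by rewrite -[x in LHS]trmxK -trmx_mul xu.
have wv0 : (w *m v0) 0 0 != 0.
  apply: contra nz_v0 => /eqP wv0; apply/eqP; apply: inj => //; first by rewrite mulmx0.
  by apply/matrixP => i j; rewrite !ord1 wv0 mulmx0 mxE.
have -> : [set v in nzcol | x *m v == v] = [set c *: v0 | c in [set~ 0]].
  apply/setP => v; rewrite !inE; apply/andP/imsetP => [[nz_v /eqP xv]|[c]].
    exists ((w *m v) 0 0 / (w *m v0) 0 0).
      rewrite !inE mulf_eq0 invr_eq0 (negPf wv0) orbF.
      apply: contra nz_v => /eqP wv; apply/eqP; apply: inj => //; first by rewrite mulmx0.
      by apply/matrixP => i j; rewrite !ord1 wv mulmx0 mxE.
    apply: inj => //; first by rewrite -scalemxAr xv0.
    by apply/matrixP => i j; rewrite !ord1 -scalemxAr [RHS]mxE divfK.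
  rewrite !inE => c0 ->; rewrite scaler_eq0 negb_or c0 nz_v0.
  by rewrite -scalemxAr xv0.
rewrite card_imset ?cardsC1 // => c c' /eqP; rewrite -subr_eq0 -scalerBl scaler_eq0.
by rewrite (negPf nz_v0) orbF subr_eq0 => /eqP.
Qed.

Lemma card_cyclic_Aff : (#|[set x in Aff F n | cyclicmx x]| * #|nzcol| =
  #|[set x : 'M[F]_n.+1 | cyclicmx x &&
      (~~ ('X %| char_poly x) && ('X - 1 %| char_poly x))%R]| * #|F|.-1)%N.
Proof.
transitivity (\sum_(v in nzcol)
    #|[set x : 'M[F]_n.+1 | [&& cyclicmx x, x \in unitmx & x *m v == v]]|)%N.
  rewrite mulnC -sum_nat_const; apply: eq_bigr => v; rewrite inE.
  case/unitmx_col_transitive => g ug def_v.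
  (* Conjugation by g, where g e = v, exchanges the matrices fixing v with those fixing e and
     preserves cyclicity. *)
  rewrite -!sum1dep_card (reindex_onto (fun x => invmx g *m x *m g)
                                       (fun x => g *m x *m invmx g)) /=.
    apply: eq_bigl => x; rewrite mem_Aff cyclicmx_conj // !unitmx_mul unitmx_inv ug andbT /=.
    rewrite !mulmxA mulmxV // mul1mx mulmxK // eqxx andbT andbC; congr [&& _, _ & _].
    rewrite -!mulmxA def_v; apply/eqP/eqP => [xv|->]; last by rewrite -def_v mulKmx.
    by rewrite -def_v -[in RHS]xv mulKVmx // def_v.
  by move=> x _; rewrite !mulmxA mulVmx // mul1mx mulmxKV.
under eq_bigr do rewrite -sum1dep_card.
rewrite (exchange_big_dep (fun x => cyclicmx x && (x \in unitmx))) /=; last first.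
  by move=> v x _ /and3P[-> ->].
rewrite -sum_nat_cond_const (bigID (fun x => ('X - 1) %| char_poly x)) /=.
(* Counted by x instead: each x with eigenvalue 1 has q - 1 nonzero fixed vectors, any other x has
   none. *)
rewrite [X in (_ + X)%N]big1 ?addn0 => [|x /andP[/andP[cx ux] nx1]].
  apply: eq_big => [x|x /andP[/andP[cx ux] x1]]; first by rewrite unitmx_char_poly andbA.
  rewrite -(card_fixed cx x1) -sum1dep_card; apply: eq_bigl => v.
  by rewrite cx ux.
rewrite big1 // => v /and4P[nz_v _ _ /eqP xv]; case/negP: nx1.
rewrite -polyC1 dvdp_XsubCl -char_poly_tr -eigenvalue_root_char; apply/eigenvalueP.
exists v^T; first by rewrite -trmx_mul xv scale1r.
by rewrite inE in nz_v; rewrite trmx_eq0.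
Qed.

(** The order of GL cancels, as does the number of nonzero columns. The index is [n.+1] because the
    matrices have n + 1 rows. *)
Lemma cA_wsum : cA F n = (qq F - 1) * wsum_dvd [:: 'X : {poly F}] ('X - 1) n.+1.
Proof.
have nz0 : (#|nzcol|%:R : rat) != 0 by rewrite pnatr_eq0 -lt0n card_nzcol_gt0.
have GL0 : (#|GLset F n|%:R : rat) != 0 by rewrite pnatr_eq0 -lt0n card_GLset_gt0.
rewrite /cA -(mulfK nz0 #|Aff F n|%:R) -natrM card_Aff invfM invrK.
rewrite (mulrC _ (#|nzcol|%:R)) mulrA -natrM card_cyclic_Aff natrM.
rewrite (card_cyclic n (fun p => ~~ ('X %| p) && (('X - 1) %| p))).
rewrite mulrC !mulrA mulVf // mul1r mulrC /qq; congr (_ * _).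
  by rewrite -subn1 natrB // ltnW // card_gt1.
by apply: eq_bigl => p /=; rewrite andbT.
Qed.

End Affine.

Theorem theorem5p5 (F : finFieldType) :
  C_A F = RHS_prod F /\ C_A F = RHS_GL F.
Proof.
have irrT (T : seq {poly F}) : {subset T <= monics F 1} ->
  {in T, forall g, g \is monic /\ irreducible_poly g}.
  move=> sT g /sT g1; split; last exact: monics1_irreducible.
  by move: g1; rewrite mem_monics => /andP[].
have X1 : 'X - 1 \in monics F 1 by rewrite -polyC1 mem_monics1_XsubC.
have X0 : 'X \in monics F 1 by rewrite -['X]subr0 mem_monics1_XsubC.
have sT1 : {subset [:: 'X : {poly F}] <= monics F 1} by move=> g; rewrite inE => /eqP ->.
have sT2 : {subset [:: 'X - 1; 'X : {poly F}] <= monics F 1}.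
  by move=> g; rewrite !inE => /orP[] /eqP ->.
have nX1 : 'X - 1 \notin [:: 'X : {poly F}].
  by rewrite inE -subr_eq0 addrAC subrr add0r oppr_eq0 oner_eq0.
have [mX1 irrX1] := irrT _ sT2 ('X - 1) (mem_head _ _).
have szX1 : size ('X - 1 : {poly F}) = 2%N by rewrite -polyC1 size_XsubC.
(* Let D and W be the sums over p prime to X, with X - 1 dividing p or not. Since c_A(n) = (q - 1)
   D_(n+1), the recursion D_(n+1) = W_n / (q - 1) + D_n / q becomes c_A(n) = W_n + c_A(n - 1) /
   q. *)
have CA : C_A F = ps_mul (ps_inv (one_minus_uq F 1)) (wsum [:: 'X - 1; 'X : {poly F}]).
  apply: ps_mul_eq_inv; first by rewrite one_minus_uq0 ?oner_eq0.
  have := wsum_dvd_rec mX1 irrX1 (irrT _ sT1) nX1; rewrite szX1 /= => recD.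
  apply/funext => n; rewrite ps_mulDl ps_mul1f ps_mulZl /ps_add /ps_scale ps_mulXE.
  have q1 := qqX_sub1_neq0 F (ltn0Sn 0); rewrite expr1 in q1.
  rewrite /C_A cA_wsum recD ps_mulXE /= subn1 /= /ps_add /ps_scale mulrDr mulVKf //.
  rewrite expr1 -addrA [X in _ + X](_ : _ = 0) ?addr0 //.
  (* For n = 0 the second term vanishes, as D_0 = 0: X - 1 divides no monic polynomial of degree
     0. *)
  case: n => [|n] /=; first by rewrite recD ps_mulXE /= !mulr0 addr0.
  by rewrite subn1 /= cA_wsum mulNr mulrCA subrr.
split; rewrite CA.
  rewrite (wsum_infprod (irrT _ sT2)) /RHS_prod; congr (ps_mul _ (ps_infprod _)).
  by apply/funext => d; rewrite size_irreds.
rewrite /RHS_GL cGL_wsum; congr (ps_mul _ _).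
(* [C_GL] differs from W by the Euler factor of X - 1 alone. *)
apply: ps_mul_eq_inv; last first.
  by rewrite (wsum_factor mX1 irrX1 (irrT _ sT1) nX1) szX1.
by rewrite /factor /ps_add ps_mulXE.
Qed.
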